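(* For every two integers $n$ and $k$ with $2\leq k\leq n$, the complete graph $K_n$ satisfies $$\lambda_k(K_n)=n-\lceil k/2\rceil.$$
   Context: All graphs are undirected, finite and simple. For a graph $G$ and a set $S\subseteq V(G)$ of at least two vertices, a tree connecting $S$ (an $S$-Steiner tree) is a subgraph $T$ of $G$ that is a tree with $S\subseteq V(T)$. Let $\lambda(S)$ be the maximum number of pairwise edge-disjoint trees connecting $S$ in $G$. The generalized $k$-edge-connectivity of $G$ is $\lambda_k(G)=\min\{\lambda(S) : S\subseteq V(G),\ |S|=k\}$. *)

(* Defs.v *)
From mathcomp Require Import all_boot.

Set Implicit Arguments.
Unset Strict Implicit.
Unset Printing Implicit Defensive.

Record sgraph := SGraph {
  vertex :> finType;
  adj : rel vertex;
  adj_sym : symmetric adj;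
  adj_irr : irreflexive adj
}.

Definition edges (G : sgraph) : {set {set G}} :=
  [set [set x; y] | x in G, y in adj x].

(* A vertex set paired with an edge set; [is_subgraph] says when such a pair is
   actually a subgraph of [G]. *)
Definition pregraph (G : sgraph) : finType := ({set G} * {set {set G}})%type.

Definition V (G : sgraph) (H : pregraph G) : {set G} := H.1.
Definition E (G : sgraph) (H : pregraph G) : {set {set G}} := H.2.

Definition is_subgraph (G : sgraph) (H : pregraph G) : bool :=
  (E H \subset edges G) && [forall e in E H, e \subset V H].

Definition subadj (G : sgraph) (H : pregraph G) : rel G :=
  [rel x y | [set x; y] \in E H].

(* The path witnessing [connect] is not explicitly confined to [V H]; when [H]
   is a subgraph this is automatic, since its edges have both ends in [V H]. *)
Definition is_connected (G : sgraph) (H : pregraph G) : bool :=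
  (V H != set0) && [forall x in V H, forall y in V H, connect (subadj H) x y].

(* A cycle has distinct vertices, hence length at most #|G|; bounding the length
   keeps the predicate boolean, see [acyclicP]. *)
Definition is_acyclic (G : sgraph) (H : pregraph G) : bool :=
  [forall n : 'I_#|G|.+1, [forall c : n.-tuple G,
     (2 < n) ==> ~~ ucycleb (subadj H) c]].

Definition is_tree (G : sgraph) (H : pregraph G) : bool :=
  is_connected H && is_acyclic H.

Definition steiner_tree (G : sgraph) (S : {set G}) (H : pregraph G) : bool :=
  [&& is_subgraph H, is_tree H & S \subset V H].

(* When #|S| >= 2 every tree connecting [S] has an edge, so edge-disjoint trees
   are distinct and a family of them is the same thing as a set of them. *)
Definition steiner_packing (G : sgraph) (S : {set G})
    (F : {set pregraph G}) : bool :=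
  [forall H in F, steiner_tree S H] &&
  [forall H1 in F, forall H2 in F, (H1 != H2) ==> [disjoint E H1 & E H2]].

Definition lambda (G : sgraph) (S : {set G}) : nat :=
  \max_(F : {set pregraph G} | steiner_packing S F) #|F|.

(* The default value of the iterated minimum is the maximum over the same range,
   so that it is neutral; see [gen_edge_connectivityP]. *)
Definition gen_edge_connectivity (k : nat) (G : sgraph) : nat :=
  let top := \max_(S : {set G} | #|S| == k) lambda S in
  \big[minn/top]_(S : {set G} | #|S| == k) lambda S.

Definition neq_rel (T : eqType) : rel T := [rel x y | x != y].

Lemma neq_rel_sym (T : eqType) : symmetric (@neq_rel T).
Proof. by move=> x y; rewrite /neq_rel /= eq_sym. Qed.

Lemma neq_rel_irr (T : eqType) : irreflexive (@neq_rel T).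
Proof. by move=> x; rewrite /neq_rel /= eqxx. Qed.

Definition complete_graph (n : nat) : sgraph :=
  SGraph (@neq_rel_sym 'I_n) (@neq_rel_irr 'I_n).

Lemma edgesP (G : sgraph) (e : {set G}) :
  reflect (exists x y : G, adj x y /\ e = [set x; y]) (e \in edges G).
Proof.
apply: (iffP imset2P) => [[x y _ xy ->] | [x [y [xy ->]]]]; first by exists x, y.
by exists x y.
Qed.

Lemma acyclicP (G : sgraph) (H : pregraph G) :
  reflect (forall c : seq G, 2 < size c -> ~ ucycle (subadj H) c)
          (is_acyclic H).
Proof.
apply: (iffP forallP) => [acyc c c_gt2 cyc | acyc n].
  have /andP[_ uniq_c] := cyc.
  have lt_c : size c < #|G|.+1 by rewrite ltnS -(card_uniqP uniq_c) max_card.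
  have /forallP/(_ (in_tuple c)) := acyc (Ordinal lt_c).
  by rewrite c_gt2 /= => /negP[].
apply/forallP=> c; apply/implyP=> n_gt2; apply/negP.
by apply: acyc; rewrite size_tuple.
Qed.

Lemma lambdaP (G : sgraph) (S : {set G}) :
  (exists2 F : {set pregraph G}, steiner_packing S F & #|F| = lambda S) /\
  (forall F : {set pregraph G}, steiner_packing S F -> #|F| <= lambda S).
Proof.
split=> [|F pF]; last exact: leq_bigmax_cond.
have p0 : steiner_packing S set0.
  by apply/andP; split; apply/forallP=> H; rewrite inE.
rewrite /lambda (bigmax_eq_arg set0) //.
by case: arg_maxnP => // F pF _; exists F.
Qed.

Lemma gen_edge_connectivityP (k : nat) (G : sgraph) : k <= #|G| ->
  (exists2 S : {set G}, #|S| = k & lambda S = gen_edge_connectivity k G) /\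
  (forall S : {set G}, #|S| = k -> gen_edge_connectivity k G <= lambda S).
Proof.
move=> le_kG.
have lb (S : {set G}) : #|S| = k -> gen_edge_connectivity k G <= lambda S.
  move=> /eqP cS; rewrite /gen_edge_connectivity /=; set top := \max_(A | _) _.
  elim: (index_enum _) (mem_index_enum S) => // A r IHr.
  rewrite inE big_cons => /predU1P[<- | /IHr le_r]; first by rewrite cS geq_minl.
  by case: ifP => // _; rewrite geq_min le_r orbT.
split=> //.
have [S0 cS0] : exists S : {set G}, #|S| == k.
  have: 0 < #|[set A : {set G} | #|A| == k]| by rewrite card_draws bin_gt0.
  by case/card_gt0P => S; rewrite inE => cS; exists S.
case: (@arg_minnP _ S0 (fun A : {set G} => #|A| == k) (@lambda G) cS0) => S /eqP cS minS.
exists S => //; apply/eqP; rewrite eqn_leq lb // andbT.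
rewrite /gen_edge_connectivity.
elim/big_ind: _ => [|a b ha hb|A cA]; last exact: minS.
- by apply: leq_bigmax_cond; apply/eqP.
- by rewrite leq_min ha hb.
Qed.

(* Main.v *)
(** Upper bound: let [#|S| = k].  A tree connecting [S] on the vertex set [S]
    has at least [k - 1] edges, all inside [S]; any other tree connecting [S]
    has at least [k] edges meeting [S].  If a packing has [t1] trees of the
    first kind and [t2] of the second, then [t1 (k - 1) <= 'C(k, 2)] and
    [t1 (k - 1) + t2 k <= 'C(k, 2) + k (n - k)], so
    [t1 + t2 <= n - k + k./2].
    Lower bound: the [n - k] stars joining a vertex outside [S] to all of [S]
    are completed by [k./2] edge-disjoint spanning trees of the clique on [S].
    Split [S] into pairs [{a_i, b_i}] (plus one vertex [c] when [k] is odd); the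
    [i]-th tree consists of [a_i b_i] (and [a_i c]), of [a_i a_j] and [b_i b_j]
    for [i < j], and of [b_i a_j] and [a_i b_j] for [j < i]. *)
Require Import Defs.
From mathcomp Require Import all_boot zify.

Set Implicit Arguments.
Unset Strict Implicit.
Unset Printing Implicit Defensive.

(** * Edges of a connected subgraph that meet a vertex set *)

Definition edges_meeting (G : sgraph) (S : {set G}) (B : {set {set G}}) :=
  [set e in B | ~~ [disjoint e & S]].

(** If no edge of [H] left [S], then [S] would be closed under [subadj H], and [x] could not reach
    [r]. *)
Lemma crossing_edge (G : sgraph) (H : pregraph G) (S : {set G}) (x r : G) :
  connect (subadj H) x r -> x \in S -> r \notin S ->
  exists y z, [/\ y \in S, z \notin S & [set y; z] \in E H].
Proof.
move=> xr xS rS.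
case: (boolP [exists y in S, exists z in ~: S, [set y; z] \in E H]).
  case/exists_inP=> y yS /exists_inP[z]; rewrite inE => zS yz.
  by exists y, z.
move=> /exists_inPn nocross; case/negP: rS.
have clS : closed (subadj H) S.
  move=> y z yz; case yS: (y \in S); case zS: (z \in S) => //.
    have /exists_inPn/(_ z) := nocross y yS.
    by rewrite inE zS => /(_ isT)/negP; case.
  have /exists_inPn/(_ y) := nocross z zS.
  by rewrite inE yS setUC => /(_ isT)/negP; case.
by rewrite -(closed_connect clS xr).
Qed.

(** Induction on [#|S|]: a crossing edge [[set y; z]] with [y] in [S] and [z] outside meets [S] but
    not [S :\ y], so deleting [y] loses at least one edge. *)
Lemma card_edges_meeting_connected (G : sgraph) (H : pregraph G) (S : {set G})
    (r : G) :
  is_connected H -> r \in V H -> S \subset V H -> r \notin S ->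
  #|S| <= #|edges_meeting S (E H)|.
Proof.
case/andP=> _ /forall_inP conH rH.
have [m] := ubnP #|S|; elim: m S => // m IHm S ltSm SH rS.
have [-> | [x xS]] := set_0Vmem S; first by rewrite cards0.
have xr : connect (subadj H) x r.
  by have /forall_inP := conH x (subsetP SH x xS); apply.
have [y [z [yS zS yz]]] := crossing_edge xr xS rS.
have cS := cardsD1 y S; rewrite yS in cS.
have IH : #|S :\ y| <= #|edges_meeting (S :\ y) (E H)|.
  apply: IHm; first by lia.
    by apply: subset_trans SH; rewrite subsetDl.
  by rewrite !inE negb_and rS orbT.
rewrite cS add1n; apply: leq_ltn_trans IH _; apply: proper_card.
apply/properP; split.
  apply/subsetP=> e; rewrite !inE => /andP[-> /=]; apply: contra.
  by apply: disjointWr; rewrite subsetDl.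
exists [set y; z]; rewrite !inE yz /=.
  by apply/pred0Pn; exists y; rewrite /= !inE eqxx yS.
rewrite negbK; apply/pred0P=> u /=; rewrite !inE.
by apply/negP => /andP[/orP[]/eqP-> /andP[]]; rewrite ?eqxx // (negPf zS).
Qed.

(** * Counting edges in a packing: the upper bound *)

Lemma edges_complete (n : nat) :
  edges (complete_graph n) = [set e : {set complete_graph n} | #|e| == 2].
Proof.
apply/setP=> e; rewrite inE; apply/edgesP/cards2P.
  by case=> x [y [xy ->]]; exists x, y.
by case=> x [y [xy ->]]; exists x, y.
Qed.

(** The edges that miss [S] are the pairs inside its complement. *)
Lemma card_edges_meeting_complete (n : nat) (S : {set complete_graph n}) :
  #|edges_meeting S (edges (complete_graph n))| + 'C(n - #|S|, 2) = 'C(n, 2).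
Proof.
rewrite edges_complete.
have -> : 'C(n, 2) = #|[set e : {set complete_graph n} | #|e| == 2]|.
  by rewrite card_draws card_ord.
rewrite -[RHS](cardsID [set e : {set complete_graph n} | ~~ [disjoint e & S]]).
congr (_ + _); first by apply: eq_card => e; rewrite !inE.
have -> : n - #|S| = #|~: S| by rewrite [RHS]cardsCs setCK card_ord.
rewrite -cards_draws; apply: eq_card => e.
by rewrite !inE negbK subsets_disjoint setCK andbC.
Qed.

(** Double counting: each element of [M] lies in at most one [B i]. *)
Lemma sum_card_disjoint_family (I T : finType) (F : {set I}) (B : I -> {set T})
    (M : {set T}) :
  {in F &, forall i j, i != j -> [disjoint B i & B j]} ->
  {in F, forall i, B i \subset M} ->
  \sum_(i in F) #|B i| <= #|M|.
Proof.
move=> disjB BM.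
have -> : \sum_(i in F) #|B i| = \sum_(i in F) \sum_(e in M) (e \in B i).
  apply: eq_bigr => i iF; rewrite -sum1_card big_mkcond [RHS]big_mkcond /=.
  apply: eq_bigr => e _.
  by have /subsetP/(_ e) := BM i iF; case: (e \in B i) => [->|] //; case: ifP.
rewrite exchange_big -[leqRHS]sum1_card /=; apply: leq_sum => e _.
have [/exists_inP[i iF ei] | /exists_inPn none] :=
  boolP [exists i in F, e \in B i].
  rewrite (bigD1 i) //= ei big1 // => j /andP[jF ji].
  by rewrite (disjointFl (disjB j i jF iF ji) ei).
by rewrite big1 // => i iF; rewrite (negPf (none i iF)).
Qed.

(** Here [d] stands for [n - k]. The first count gives [2 * t1 <= k]; adding [t1] to both sides of
    the second turns its left side into [(t1 + t2) * k + 'C(d, 2)], whence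
    [2 * (t1 + t2) <= k + 2 * d]. *)
Lemma card_packing_arith (k d t1 t2 : nat) : 2 <= k ->
  t1 * k.-1 <= 'C(k, 2) -> t1 * k.-1 + t2 * k + 'C(d, 2) <= 'C(k + d, 2) ->
  t1 + t2 <= k + d - uphalf k.
Proof.
move=> k2 count1 count2.
have bin2_double m : 2 * 'C(m, 2) = m * m.-1 by rewrite -mul_bin_diag bin1.
have bk := bin2_double k; have bd := bin2_double d.
have := bin2_double (k + d).
have -> : (k + d) * (k + d).-1 = k * k.-1 + 2 * (k * d) + d * d.-1.
  by case: k {k2 count1 count2 bk} => [|k']; case: d {bd} => [|d'] /=; lia.
move=> bkd.
have few : 2 * t1 <= k by rewrite -(@leq_pmul2r k.-1); lia.
have t1E : t1 * k = t1 * k.-1 + t1 by rewrite -mulnSr prednK //; lia.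
have kE : k * k = k * k.-1 + k by rewrite -mulnSr prednK //; lia.
have : k * (2 * (t1 + t2)) <= k * (k + 2 * d) by lia.
by rewrite leq_pmul2l; lia.
Qed.

Lemma packing_complete_ub (n : nat) (S : {set complete_graph n})
    (F : {set pregraph (complete_graph n)}) :
  2 <= #|S| -> steiner_packing S F -> #|F| <= n - uphalf #|S|.
Proof.
set k := #|S| => k2 /andP[/forall_inP treeF /forall_inP disjF].
have kn : k <= n by rewrite -[leqRHS](card_ord n); apply: max_card.
have disj : {in F &, forall H1 H2, H1 != H2 -> [disjoint E H1 & E H2]}.
  move=> H1 H2 F1 F2; have /forall_inP/(_ H2 F2) := disjF H1 F1.
  by move/implyP.
pose F1 := [set H in F | V H == S]; pose F2 := [set H in F | V H != S].
have cF : #|F| = #|F1| + #|F2|.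
  rewrite -(cardsID [set H : pregraph (complete_graph n) | V H == S]).
  by congr (_ + _); apply: eq_card => H; rewrite !inE andbC // andbC.
have cM := card_edges_meeting_complete S; rewrite -/k in cM.
have inner H : H \in F1 -> k.-1 <= #|edges_meeting S (E H)|.
  rewrite inE => /andP[HF /eqP VH].
  have /and3P[_ /andP[conH _] SH] := treeF H HF.
  have [r rS] : exists r, r \in S by apply/card_gt0P; lia.
  have cS : k.-1 = #|S :\ r| by rewrite /k (cardsD1 r S) rS.
  (* The tree has no vertex outside [S], so a vertex [r] of [S] serves as the outer vertex for
     [S :\ r]; this costs one edge. *)
  rewrite cS; apply: leq_trans (_ : _ <= #|edges_meeting (S :\ r) (E H)|) _.
    apply: (card_edges_meeting_connected (r := r)); rewrite ?VH //.
      by rewrite subsetDl.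
    by rewrite !inE eqxx.
  apply/subset_leq_card/subsetP=> e; rewrite !inE => /andP[-> /=].
  by apply: contra; apply: disjointWr; rewrite subsetDl.
have outer H : H \in F2 -> k <= #|edges_meeting S (E H)|.
  rewrite inE => /andP[HF VH]; have /and3P[_ /andP[conH _] SH] := treeF H HF.
  have /properP[_ [r rH rS]] : S \proper V H by rewrite properEneq eq_sym VH.
  exact: card_edges_meeting_connected rH SH rS.
have count1 : #|F1| * k.-1 <= 'C(k, 2).
  (* The edges of a tree with vertex set [S] are among the 2-subsets of [S]. *)
  rewrite /k -cards_draws -sum_nat_const.
  apply: leq_trans (leq_sum _ inner) _; apply: sum_card_disjoint_family.
    move=> H1 H2 /setIdP[H1F _] /setIdP[H2F _] /(disj _ _ H1F H2F) dH.
    by apply: disjointW dH; apply/subsetP=> e /setIdP[].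
  move=> H /setIdP[HF /eqP VH].
  have /and3P[/andP[EG /forall_inP EV] _ _] := treeF H HF.
  apply/subsetP=> e /setIdP[eE _]; rewrite inE -VH EV //=.
  by have := subsetP EG e eE; rewrite edges_complete inE.
have count2 : #|F1| * k.-1 + #|F2| * k + 'C(n - k, 2) <= 'C(n, 2).
  rewrite -cM leq_add2r -!sum_nat_const.
  apply: leq_trans (leq_add (leq_sum _ inner) (leq_sum _ outer)) _.
  have -> : \sum_(H in F1) #|edges_meeting S (E H)| +
            \sum_(H in F2) #|edges_meeting S (E H)| =
            \sum_(H in F) #|edges_meeting S (E H)|.
    rewrite [RHS](bigID (fun H => V H == S)) /=.
    by congr (_ + _); apply: eq_bigl => H; rewrite inE.
  apply: sum_card_disjoint_family.
    move=> H1 H2 H1F H2F /(disj _ _ H1F H2F) dH.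
    by apply: disjointW dH; apply/subsetP=> e /setIdP[].
  move=> H HF; have /and3P[/andP[EG _] _ _] := treeF H HF.
  apply/subsetP=> e; rewrite !inE => /andP[eE ->]; rewrite andbT.
  exact: subsetP EG e eE.
rewrite cF; have -> : n - uphalf k = k + (n - k) - uphalf k by lia.
by apply: card_packing_arith; rewrite ?subnKC.
Qed.

(** * Trees given by a root and a parent function *)

Definition parent_tree (G : sgraph) (A : {set G}) (r : G) (p : G -> G) :
    pregraph G :=
  (A, [set [set x; p x] | x in A :\ r]).

Lemma parent_tree_subgraph (G : sgraph) (A : {set G}) (r : G) (p : G -> G) :
  {in A :\ r, forall x, p x \in A /\ adj x (p x)} ->
  is_subgraph (parent_tree A r p).
Proof.
move=> pA; apply/andP; split.
  apply/subsetP=> _ /imsetP[x xA ->]; apply/edgesP.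
  by exists x, (p x); split=> //; case: (pA x xA).
apply/forall_inP=> _ /imsetP[x xA ->]; have [pxA _] := pA x xA.
by move: xA; rewrite subUset !sub1set pxA inE => /andP[_ ->].
Qed.

(** Iterating [p] lowers the rank and stays in [A], so it must end at [r]. *)
Lemma parent_tree_connected (G : sgraph) (A : {set G}) (r : G) (p : G -> G)
    (rk : G -> nat) :
  r \in A -> {in A :\ r, forall x, p x \in A /\ rk (p x) < rk x} ->
  is_connected (parent_tree A r p).
Proof.
move=> rA pA; apply/andP; split; first by apply/set0Pn; exists r.
have sym : connect_sym (subadj (parent_tree A r p)).
  by apply: sym_connect_sym => x y; rewrite /subadj /= setUC.
suff toroot x : x \in A -> connect (subadj (parent_tree A r p)) x r.
  apply/forall_inP=> x xA; apply/forall_inP=> y yA.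
  by apply: connect_trans (toroot x xA) _; rewrite sym toroot.
have [m] := ubnP (rk x); elim: m x => // m IHm x ltxm xA.
have [-> | xr] := eqVneq x r; first exact: connect0.
have xAr : x \in A :\ r by rewrite !inE xr.
have [pxA ltp] := pA x xAr.
apply: connect_trans (connect1 _) (IHm (p x) _ pxA); last by lia.
by apply/imsetP; exists x.
Qed.

(* Both neighbours on a cycle of a vertex of maximal rank would be its parent. *)
Lemma parent_tree_acyclic (G : sgraph) (A : {set G}) (r : G) (p : G -> G)
    (rk : G -> nat) :
  {in A :\ r, forall x, rk (p x) < rk x} ->
  is_acyclic (parent_tree A r p).
Proof.
move=> pA; apply/acyclicP=> c c2 /andP[cyc uc].
(* A parent has strictly smaller rank, so the end of an edge whose rank is not the smaller is the
   child. *)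
have edge_up x y : rk y <= rk x -> subadj (parent_tree A r p) x y -> y = p x.
  move=> le_yx /imsetP[z zA exy]; have := pA z zA.
  have : x \in [set z; p z] by rewrite -exy !inE eqxx.
  have : y \in [set z; p z] by rewrite -exy !inE eqxx orbT.
  have : p z \in [set x; y] by rewrite exy !inE eqxx orbT.
  have : z \in [set x; y] by rewrite exy !inE eqxx.
  rewrite !inE.
  do 4![case/orP => /eqP ?]; subst => //; lia.
have [x0 x0c] : exists x0, x0 \in c.
  by case: (c) c2 => // x s _; exists x; rewrite mem_head.
have [x xc xmax] : exists2 x, x \in c & {in c, forall y, rk y <= rk x}.
  by case: (@arg_maxnP _ x0 (mem c) rk x0c) => x; exists x.
have [i s rot_c] := rot_to xc.
have us : uniq (x :: s) by rewrite -rot_c rot_uniq.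
have cs : cycle (subadj (parent_tree A r p)) (x :: s) by rewrite -rot_c rot_cycle.
have smax : {in x :: s, forall y, rk y <= rk x}.
  by move=> y; rewrite -rot_c mem_rot; apply: xmax.
have : 2 < size (x :: s) by rewrite -rot_c size_rot.
case: s us cs smax {rot_c} => [|y s] //; case/lastP: s => [|s z] // us cs smax _.
move: cs; rewrite /= rcons_path rcons_path last_rcons.
case/and3P=> xy _ zx.
have ey : y = p x by apply: edge_up xy; apply: smax; rewrite !inE eqxx orbT.
have ez : z = p x.
  apply: edge_up; last by rewrite /subadj /= setUC.
  by apply: smax; rewrite !inE mem_rcons mem_head !orbT.
by move: us; rewrite /= mem_rcons ey ez mem_head andbF.
Qed.

(** * An explicit packing: the lower bound *)

(* The vertices are numbered so that those of [S] come first, and a tree of the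
   packing is described by its root [r] and its parent function:
   [k <= r] for a star centred outside [S], and [r = 2 i] for the [i]-th tree on
   [S], with [a_i] and [b_i] numbered [2 i] and [2 i + 1]. *)
Definition parent_num (k r j : nat) : nat :=
  if (k <= r) || (j == r.+1) then r
  else if r < j then r + odd j else r + ~~ odd j.

Definition root_num (k i : nat) : nat :=
  if i < k./2 then i.*2 else i - k./2 + k.

(** Not the exact depth: other children of [r] also get rank 2. It suffices that every parent is [r]
    or [r.+1] and that rank drops from child to parent. *)
Definition rank_num (r j : nat) : nat :=
  if j == r then 0 else if j == r.+1 then 1 else 2.

Lemma parent_num_rank (k r j : nat) : j != r ->
  rank_num r (parent_num k r j) < rank_num r j.
Proof.
rewrite /rank_num /parent_num.
case: (odd j); repeat case: ifP; lia.
Qed.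

(** Keeps parents inside the tree: for [i < k./2] the partner [r.+1] of the root is still below
    [k]. *)
Lemma parent_num_ub (k i j : nat) : j < k ->
  let r := root_num k i in parent_num k r j < k \/ parent_num k r j = r.
Proof.
rewrite /root_num /parent_num.
case: (odd j); repeat case: ifP; lia.
Qed.

(** Of the four edges between two pairs, the tree of smaller index takes those joining equal
    parities and the other tree those joining opposite parities. Every edge of a star contains its
    centre, numbered at least [k]. *)
Lemma parent_num_disjoint (k i i' j j' : nat) :
  let r := root_num k i in let r' := root_num k i' in
  j < k -> j' < k -> j != r -> j' != r' -> i != i' ->
  ~ (j = j' /\ parent_num k r j = parent_num k r' j') /\
  ~ (j = parent_num k r' j' /\ parent_num k r j = j').
Proof.
rewrite /root_num /parent_num /=.
case: ifP; case: ifP; repeat case: ifP; lia.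
Qed.

Lemma set2_eq_cases (T : finType) (x x' y y' : T) :
  [set x; x'] = [set y; y'] -> x = y /\ x' = y' \/ x = y' /\ x' = y.
Proof.
move=> e.
have : x \in [set y; y'] by rewrite -e set21.
have : x' \in [set y; y'] by rewrite -e set22.
have : y \in [set x; x'] by rewrite e set21.
have : y' \in [set x; x'] by rewrite e set22.
by do 4![case/set2P => ?]; subst; auto.
Qed.

Lemma packing_complete_lb (n : nat) (S : {set complete_graph n}) :
  2 <= #|S| ->
  exists2 F : {set pregraph (complete_graph n)},
    steiner_packing S F & #|F| = n - uphalf #|S|.
Proof.
set k := #|S| => k2.
have kn : k <= n by rewrite -[leqRHS](card_ord n); apply: max_card.
have x0 : complete_graph n by apply: (@Ordinal n 0); lia.
pose s := enum S ++ enum (~: S).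
have size_s : size s = n.
  by rewrite size_cat -!cardE cardsC card_ord.
have mem_s x : x \in s by rewrite mem_cat !mem_enum inE orbN.
have uniq_s : uniq s.
  rewrite cat_uniq !enum_uniq andbT /=; apply/hasPn=> x.
  by rewrite !mem_enum inE.
pose num x := index x s; pose vtx j := nth x0 s j.
have num_lt x : num x < n by rewrite -size_s index_mem.
have numK : cancel num vtx by move=> x; apply: nth_index.
have vtxK j : j < n -> num (vtx j) = j.
  by move=> jn; apply: index_uniq; rewrite // size_s.
have num_S x : (num x < k) = (x \in S).
  rewrite /num index_cat mem_enum /k cardE; case: ifP => xS.
    by rewrite index_mem mem_enum.
  by rewrite ltnNge leq_addr.
(* This is [k./2 + (n - k)]: the trees on [S] followed by the stars. *)
pose m := n - uphalf k.
have root_lt (i : 'I_m) : root_num k i < n.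
  have := ltn_ord i; rewrite /root_num /m; case: ifP; lia.
pose r (i : 'I_m) := vtx (root_num k i).
have num_r i : num (r i) = root_num k i by rewrite vtxK.
pose p i x := vtx (parent_num k (root_num k i) (num x)).
(* This is [S] itself when the root lies in [S], so both kinds of tree are treated alike. *)
pose A i := r i |: S.
have numA i x : x \in A i :\ r i -> num x < k /\ num x != root_num k i.
  rewrite !inE => /andP[xr]; rewrite (negPf xr) /= -num_S => xk; split=> //.
  by rewrite -num_r (inj_eq (can_inj numK)).
have num_p i x : x \in A i :\ r i ->
    num (p i x) = parent_num k (root_num k i) (num x).
  move=> /numA[xk _]; apply: vtxK.
  by have := parent_num_ub i xk; have := root_lt i; lia.
pose T i := parent_tree (A i) (r i) (p i).
have pA i : {in A i :\ r i, forall x, p i x \in A i}.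
  move=> x xA; have [xk _] := numA i x xA.
  have /= := parent_num_ub i xk; rewrite -(num_p i x xA) !inE num_S.
  by case=> [-> | e]; rewrite ?orbT // -[p i x]numK e eqxx.
pose rk i x := rank_num (root_num k i) (num x).
have rkA i : {in A i :\ r i, forall x, rk i (p i x) < rk i x}.
  move=> x xA; rewrite /rk (num_p i x xA); apply: parent_num_rank.
  by case: (numA i x xA).
have treeT i : steiner_tree S (T i).
  apply/and3P; split; last by rewrite subsetUr.
    apply: parent_tree_subgraph => x xA; split; first exact: pA.
    by rewrite /= /neq_rel /=; apply/eqP=> e; have := rkA i x xA; rewrite -e ltnn.
  apply/andP; split; last exact: parent_tree_acyclic (rkA i).
  apply: (parent_tree_connected (rk := rk i)); first by rewrite !inE eqxx.
  by move=> x xA; split; [apply: pA | apply: rkA].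
have disjT i j : i != j -> [disjoint E (T i) & E (T j)].
  move=> ij; apply/pred0P=> e /=; apply/negP=> /andP[/imsetP[x xA ->]].
  case/imsetP=> y yA exy.
  have [xk xr] := numA i x xA; have [yk yr] := numA j y yA.
  have [] := parent_num_disjoint xk yk xr yr ij.
  rewrite -(num_p i x xA) -(num_p j y yA).
  by case: (set2_eq_cases exy) => -[-> ->] ? ?; auto.
(* If [T i = T j] with [i != j], the common edge set would be disjoint from itself, hence empty; but
   [2 <= #|S|] leaves a non-root vertex and its parent edge. *)
have injT : injective T.
  move=> i j eT; apply/eqP/negP=> /negP/disjT; rewrite eT -setI_eq0 setIid.
  have [x xS] : exists x, x \in S :\ r j.
    by apply/card_gt0P; have := cardsD1 (r j) S; lia.
  apply/negP/set0Pn; exists [set x; p j x]; apply: imset_f.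
  by move: xS; rewrite !inE => /andP[-> ->]; rewrite orbT.
exists (T @: [set: 'I_m]); last by rewrite card_imset // cardsT card_ord.
apply/andP; split; first by apply/forall_inP=> _ /imsetP[i _ ->].
apply/forall_inP=> _ /imsetP[i _ ->]; apply/forall_inP=> _ /imsetP[j _ ->].
by apply/implyP=> Tij; apply: disjT; apply: contraNneq Tij => ->.
Qed.

Theorem theorem3 (n k : nat) (hk : 2 <= k) (hkn : k <= n) :
  gen_edge_connectivity k (complete_graph n) = n - uphalf k.
Proof.
(* Both bounds hold for every [k]-set, so it suffices to evaluate [lambda] at one attaining the
   minimum. *)
have [|[S cS <-] _] := @gen_edge_connectivityP k (complete_graph n).
  by rewrite card_ord.
have [[F packF cF] maxF] := lambdaP S.
have S2 : 2 <= #|S| by rewrite cS.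
apply/eqP; rewrite eqn_leq -{1}cF -cS packing_complete_ub //=.
by have [F' packF' <-] := packing_complete_lb S2; apply: maxF.
Qed.
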